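(* Let $y\in\mathbb{R}^N$ be a unit vector with $y\notin\mathcal{R}_{\ell}$ and let $\varepsilon>0$ be the stopping tolerance. Suppose LSQRNV started from $y$ terminates at iteration $i\geq 1$ by the stopping criterion $$\|Ax_i\|\le\|A\|\,\|x_i\|\,\varepsilon ,$$ and that the scalar $\Delta_i$ defined in the context satisfies $\Delta_i\epsilon^2<1$. Then the returned approximation $\tilde x=x_i$ satisfies $$\sin\angle(\mathcal{N}_{\epsilon},\tilde x)\le\kappa\,\varepsilon .$$
   Context: Matrix setting. $A\in\mathbb{R}^{M\times N}$ has singular values $\sigma_1\ge\dots\ge\sigma_N\ge 0$ (the nonnegative square roots of the eigenvalues of $A^TA$), normalized so that $\sigma_1=1$. Fix $1\le\ell<N$ with $\sigma_\ell>\sigma_{\ell+1}$ (the numerical rank) and put $\kappa=\sigma_1/\sigma_\ell$ (numerical condition number) and $\epsilon=\sigma_{\ell+1}/\sigma_1$ (not to be confused with the tolerance $\varepsilon$). Let $W=[W_\ell,W_\epsilon]\in\mathbb{R}^{N\times N}$ be an orthogonal matrix of right singular vectors, with $W_\ell$ having $\ell$ columns, so that $A^TA=W_\ell\Sigma_\ell^2W_\ell^T+W_\epsilon\Sigma_\epsilon^2W_\epsilon^T$, where $\Sigma_\ell=\mathrm{diag}(\sigma_1,\dots,\sigma_\ell)$ and $\Sigma_\epsilon=\mathrm{diag}(\sigma_{\ell+1},\dots,\sigma_N)$. Define $\mathcal{R}_\ell=\mathrm{span}(W_\ell)$ (numerical range space of $A^T$) and $\mathcal{N}_\epsilon=\mathrm{span}(W_\epsilon)$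 (numerical null space of $A$). $\|\cdot\|$ is the Euclidean/spectral norm. For a nonzero vector $v$, $\angle(\mathcal{N}_\epsilon,v)\in[0,\pi/2]$ is the acute angle: $\sin\angle(\mathcal{N}_\epsilon,v)=\|W_\ell^Tv\|/\|v\|$, $\cos\angle(\mathcal{N}_\epsilon,v)=\|W_\epsilon^Tv\|/\|v\|$. LSQRNV iterates (exact arithmetic). Started from the unit vector $y$, the $i$th iterate is $x_i=y-A^Tz_i$, where $z_i$ minimizes $\|y-A^T\tilde z\|$ over $\tilde z$ in the Krylov subspace $\mathcal{U}_i=\mathrm{span}\{Ay,(AA^T)Ay,\dots,(AA^T)^{i-1}Ay\}$. An index $i$ is reached if there is no breakdown before it, so $\dim\mathcal{U}_i=i$. Polynomials. Let $\Psi_i$ be the set of real polynomials $\psi$ of degree at most $i$ with $\psi(0)=1$. Let $\psi_i\in\Psi_i$ be a minimizer of $\|\psi(A^TA)y\|$ over $\psi\in\Psi_i$, so that $x_i=\psi_i(A^TA)y$. With $g_\ell=W_\ell^Ty$, let $\widehat\psi_i\in\Psi_i$ be a (fixed) minimizer of $\|\psi(\Sigma_\ell^2)g_\ell\|$ over $\psi\in\Psi_i$. Let $\phi_i,\hat\phi_i$ be the polynomials of degree at most $i-1$ with $\psi_i(\varsigma)=1+\varsigma\phi_i(\varsigma)$ and $\widehat\psi_i(\varsigma)=1+\varsigma\hat\phi_i(\varsigma)$. Define $$\Delta_i=\max\Big\{\max_{0\le\varsigma\le\epsilon^2}|\phi_i(\varsigma)|,\ \max_{0\le\varsigma\le\epsilon^2}|\hat\phi_i(\varsigma)|\Big\}.$$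 *)

(* Defs.v *)
From HB Require Import structures.
From mathcomp Require Import all_boot all_order all_algebra.
From mathcomp Require Import all_classical all_reals all_analysis.

Set Implicit Arguments.
Unset Strict Implicit.
Unset Printing Implicit Defensive.

Import Order.TTheory GRing.Theory Num.Theory.
Local Open Scope classical_set_scope.
Local Open Scope ring_scope.

(* The library's norm `|x| on matrices is the max norm, so the Euclidean norm
   and the spectral norm it induces are introduced here. *)
Definition enorm (R : realType) (n : nat) (x : 'cV[R]_n) : R :=
  Num.sqrt (\sum_i x i 0 ^+ 2).

Definition specnorm (R : realType) (m n : nat) (A : 'M[R]_(m, n)) : R :=
  sup [set enorm (A *m x) | x in [set x : 'cV[R]_n | enorm x = 1]].

Definition orthogonal_mx (R : realType) (m n : nat) (W : 'M[R]_(m, n)) : Prop :=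
  W^T *m W = 1%:M /\ W *m W^T = 1%:M.

(* p(B) for a square matrix of any order; horner_mx requires the order to be
   syntactically a successor. *)
Definition mxhorner (R : realType) (n : nat) (p : {poly R}) (B : 'M[R]_n) :
  'M[R]_n := \sum_(j < size p) p`_j *: B ^+ j.

(* sigma is indexed from 1: only sigma 1, ..., sigma n are meaningful.
   The eigenvalues of A^T A are counted with multiplicity. *)
Definition singular_values (R : realType) (m n : nat) (A : 'M[R]_(m, n))
    (sigma : nat -> R) : Prop :=
  [/\ forall j, (1 <= j <= n)%N -> 0 <= sigma j,
      forall j k, (1 <= j <= k)%N -> (k <= n)%N -> sigma k <= sigma j
    & char_poly (A^T *m A)
        = \prod_(1 <= j < n.+1) ('X - (sigma j ^+ 2)%:P)].

(* diag (sigma_1, ..., sigma_l) *)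
Definition Sigma_l (R : realType) (sigma : nat -> R) (l : nat) : 'M[R]_l :=
  diag_mx (\row_(j < l) sigma j.+1).

(* diag (sigma_{l+1}, ..., sigma_n) *)
Definition Sigma_eps (R : realType) (sigma : nat -> R) (n l : nat) :
  'M[R]_(n - l) := diag_mx (\row_(j < n - l) sigma (l + j.+1)%N).

Definition right_singular_basis (R : realType) (m n l : nat)
    (A : 'M[R]_(m, n)) (sigma : nat -> R)
    (Wl : 'M[R]_(n, l)) (We : 'M[R]_(n, n - l)) : Prop :=
  orthogonal_mx (row_mx Wl We) /\
  A^T *m A = Wl *m Sigma_l sigma l ^+ 2 *m Wl^T
           + We *m Sigma_eps sigma n l ^+ 2 *m We^T.

(* Membership in the span of the columns of W; mxalgebra works with rows. *)
Definition in_col_span (R : realType) (n p : nat)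
    (W : 'M[R]_(n, p)) (v : 'cV[R]_n) : bool := (v^T <= W^T)%MS.

(* Angle between a nonzero v and the span of the columns of W, for W with
   orthonormal columns. *)
Definition angle (R : realType) (n p : nat)
    (W : 'M[R]_(n, p)) (v : 'cV[R]_n) : R :=
  acos (enorm (W^T *m v) / enorm v).

(* Columns: (A A^T)^j A y for 0 <= j < i. *)
Definition krylov (R : realType) (m n : nat) (A : 'M[R]_(m, n)) (y : 'cV[R]_n)
    (i : nat) : 'M[R]_(m, i) :=
  \matrix_(k < m, j < i) ((A *m A^T) ^+ j *m (A *m y)) k 0.

Definition lsqrnv_reached (R : realType) (m n : nat) (A : 'M[R]_(m, n))
    (y : 'cV[R]_n) (i : nat) : Prop := \rank (krylov A y i) = i.

Definition lsqrnv_iterate (R : realType) (m n : nat) (A : 'M[R]_(m, n))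
    (y : 'cV[R]_n) (i : nat) (x : 'cV[R]_n) : Prop :=
  exists z : 'cV[R]_m,
    [/\ in_col_span (krylov A y i) z,
        forall z' : 'cV[R]_m, in_col_span (krylov A y i) z' ->
          enorm (y - A^T *m z) <= enorm (y - A^T *m z')
      & x = y - A^T *m z].

Definition stop_criterion (R : realType) (m n : nat) (A : 'M[R]_(m, n))
    (tol : R) (x : 'cV[R]_n) : bool :=
  enorm (A *m x) <= specnorm A * enorm x * tol.

(* The criterion is tested at iterations 1, 2, ..., and i is the first one at
   which it holds. *)
Definition lsqrnv_terminates (R : realType) (m n : nat) (A : 'M[R]_(m, n))
    (y : 'cV[R]_n) (tol : R) (i : nat) (x : 'cV[R]_n) : Prop :=
  [/\ lsqrnv_reached A y i,
      lsqrnv_iterate A y i x,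
      stop_criterion A tol x
    & forall (j : nat) (x' : 'cV[R]_n), (1 <= j < i)%N ->
        lsqrnv_iterate A y j x' -> ~~ stop_criterion A tol x'].

Definition Psi (R : realType) (i : nat) (psi : {poly R}) : Prop :=
  (size psi <= i.+1)%N /\ psi.[0] = 1.

Definition residual_minimizer (R : realType) (n : nat) (B : 'M[R]_n)
    (g : 'cV[R]_n) (i : nat) (psi : {poly R}) : Prop :=
  Psi i psi /\
  forall q : {poly R}, Psi i q ->
    enorm (mxhorner psi B *m g) <= enorm (mxhorner q B *m g).

Definition max_abs_poly (R : realType) (phi : {poly R}) (b : R) : R :=
  sup [set `|phi.[t]| | t in `[0, b]].

Definition Delta (R : realType) (phi phihat : {poly R}) (eps : R) : R :=
  Num.max (max_abs_poly phi (eps ^+ 2)) (max_abs_poly phihat (eps ^+ 2)).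

(* Main.v *)
Require Import Defs.
From HB Require Import structures.
From mathcomp Require Import all_boot all_order all_algebra.
From mathcomp Require Import all_classical all_reals all_analysis.
From mathcomp Require Import ring lra.
Import Order.TTheory GRing.Theory Num.Theory.
Local Open Scope ring_scope.

(** Write B for A^T A and s_j for the singular values.

    The iterate x is the vector of least norm in the affine space
    y - A^T U_i, where U_i is the Krylov space. That space is exactly the set
    of all q(B) y with q of degree at most i and q(0) = 1, and a vector of
    least norm in an affine space is unique, so x = psi(B) y
    ([lsqrnv_iterateE]).

    This gives x <> 0: the component of x along the right singular vector
    w_j is psi(s_j^2) times that of y. For j > l we have
    0 <= s_j^2 <= eps^2, hence
    |psi(s_j^2) - 1| = s_j^2 |phi(s_j^2)| <= eps^2 Delta < 1 and psi does not
    vanish at s_j^2. As y is not in the range of W_l, one of its components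
    along these w_j is nonzero, and so is that of x
    ([null_component_nonzero]).

    The sine of the angle is |W_l^T x| / |x| ([sin_angle_complement]). In
    the expansion of |A x|^2 along the singular vectors
    ([sqnorm_mul_svd]), the first l terms alone give
    s_l |W_l^T x| <= |A x|, while the stopping criterion and |A| <= s_1 = 1
    ([specnorm_le_sigma1]) give |A x| <= tol |x|. Dividing by s_l |x| yields
    the bound, since kappa = 1 / s_l. *)

Set Implicit Arguments.
Unset Strict Implicit.
Unset Printing Implicit Defensive.

(** * The squared Euclidean norm *)

Definition sqnorm (R : realType) (n : nat) (u : 'cV[R]_n) : R :=
  \sum_i u i 0 ^+ 2.

Lemma sqnorm_ge0 (R : realType) (n : nat) (u : 'cV[R]_n) : 0 <= sqnorm u.
Proof. by apply: sumr_ge0 => k _; exact: sqr_ge0. Qed.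

Lemma sqnormE (R : realType) (n : nat) (u : 'cV[R]_n) :
  sqnorm u = (u^T *m u) 0 0.
Proof. by rewrite mxE; apply: eq_bigr => k _; rewrite mxE expr2. Qed.

Lemma sqnorm_eq0 (R : realType) (n : nat) (u : 'cV[R]_n) :
  (sqnorm u == 0) = (u == 0).
Proof.
apply/eqP/eqP => [u0|->]; last by apply: big1 => k _; rewrite mxE expr0n.
apply/colP => k; rewrite mxE; apply/eqP; rewrite -sqrf_eq0.
by have /psumr_eq0P/(_ u0 k isT)-> : forall j : 'I_n, true -> 0 <= u j 0 ^+ 2
  by move=> j _; exact: sqr_ge0.
Qed.

Lemma enormE (R : realType) (n : nat) (u : 'cV[R]_n) :
  enorm u = Num.sqrt (sqnorm u).
Proof. by []. Qed.

Lemma enorm_sqr (R : realType) (n : nat) (u : 'cV[R]_n) :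
  enorm u ^+ 2 = sqnorm u.
Proof. by rewrite enormE sqr_sqrtr// sqnorm_ge0. Qed.

Lemma ler_enorm (R : realType) (m n : nat) (u : 'cV[R]_m) (v : 'cV[R]_n) :
  (enorm u <= enorm v) = (sqnorm u <= sqnorm v).
Proof. by rewrite !enormE ler_sqrt// sqnorm_ge0. Qed.

Lemma sqnorm_parallelogram (R : realType) (n : nat) (u v : 'cV[R]_n) :
  4 * sqnorm (2^-1 *: (u + v)) + sqnorm (u - v)
    = 2 * sqnorm u + 2 * sqnorm v.
Proof.
rewrite /sqnorm !mulr_sumr -!big_split /=; apply: eq_bigr => k _.
by rewrite !mxE; field.
Qed.

(** Uniqueness of the least norm in a convex set: two minimizers have their
    midpoint in the set, and by the parallelogram identity it would be
    strictly shorter unless they coincide. Only these two inequalities about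
    u and v are used, so no set appears. *)
Lemma min_enorm_unique (R : realType) (n : nat) (u v : 'cV[R]_n) :
  enorm v <= enorm u -> enorm u <= enorm (2^-1 *: (u + v)) -> u = v.
Proof.
rewrite !ler_enorm => vu uw; have := sqnorm_parallelogram u v.
have := sqnorm_ge0 (u - v) => uv0 E.
by apply/eqP; rewrite -subr_eq0 -sqnorm_eq0; apply/eqP; lra.
Qed.

(** * LSQRNV iterates as polynomials in the Gram matrix *)

Lemma mxhornerE (R : realType) (n k : nat) (p : {poly R}) (B : 'M[R]_n) :
  (size p <= k)%N -> mxhorner p B = \sum_(j < k) p`_j *: B ^+ j.
Proof.
move=> pk; rewrite /mxhorner (big_ord_widen _ (fun j => p`_j *: B ^+ j) pk).
rewrite big_mkcond; apply: eq_bigr => j _; case: ltnP => // pj.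
by rewrite nth_default// scale0r.
Qed.

Lemma size_1addXmul (R : realType) (i : nat) (p : {poly R}) :
  (size p <= i)%N -> (size (1 + 'X * p)%R <= i.+1)%N.
Proof.
move=> pi; rewrite (leq_trans (size_polyD _ _))// size_poly1 geq_max /=.
by rewrite (leq_trans (size_polyMleq _ _))// size_polyX.
Qed.

Lemma mxhorner_1addXmul (R : realType) (n i : nat) (p : {poly R})
    (B : 'M[R]_n) : (size p <= i)%N ->
  mxhorner (1 + 'X * p) B = 1%:M + \sum_(j < i) p`_j *: B ^+ j.+1.
Proof.
move=> pi; rewrite (mxhornerE (k := i.+1)) ?size_1addXmul//.
rewrite big_ord_recl /= coefD coefXM coef1 addr0 scale1r expr0; congr (_ + _).
by apply: eq_bigr => j _; rewrite coefD coef1 coefXM /= add0r.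
Qed.

Lemma mul_trmx_exp (R : realType) (m n : nat) (A : 'M[R]_(m, n)) (j : nat) :
  A^T *m ((A *m A^T) ^+ j *m A) = (A^T *m A) ^+ j.+1.
Proof.
elim: j => [|j IHj]; first by rewrite expr0 expr1 mul1mx.
by rewrite exprS [in RHS]exprS -IHj -!mulmxE !mulmxA.
Qed.

(** Since A^T (A A^T)^j A = (A^T A)^(j+1), applying A^T to the Krylov space
    gives the vectors q(A^T A) y with q of degree at most i and no constant
    term. *)
Lemma krylov_mul (R : realType) (m n i : nat) (A : 'M[R]_(m, n))
    (y : 'cV[R]_n) (c : 'cV[R]_i) :
  A^T *m (krylov A y i *m c)
    = (\sum_(j < i) c j 0 *: (A^T *m A) ^+ j.+1) *m y.
Proof.
have -> : krylov A y i *m c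
    = \sum_(j < i) c j 0 *: ((A *m A^T) ^+ j *m (A *m y)).
  apply/colP => k; rewrite mxE summxE; apply: eq_bigr => j _.
  by rewrite !mxE mulrC.
rewrite mulmx_sumr mulmx_suml; apply: eq_bigr => j _.
by rewrite -scalemxAr -scalemxAl -mul_trmx_exp !mulmxA.
Qed.

Lemma in_col_spanP (R : realType) (n p : nat) (W : 'M[R]_(n, p))
    (v : 'cV[R]_n) : reflect (exists c : 'cV[R]_p, v = W *m c) (in_col_span W v).
Proof.
apply: (iffP idP) => [/submxP[D vD]|[c ->]].
  by exists D^T; apply: trmx_inj; rewrite vD trmx_mul trmxK.
by rewrite /in_col_span trmx_mul submxMl.
Qed.

(** The two minimization problems range over the same affine space: a
    coefficient vector c of z corresponds to the polynomial with
    coefficients -c. Each minimizer is therefore a competitor for the other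
    problem, and [min_enorm_unique] identifies them. *)
Lemma lsqrnv_iterateE (R : realType) (m n i : nat) (A : 'M[R]_(m, n))
    (y x : 'cV[R]_n) (psi phi : {poly R}) :
  lsqrnv_iterate A y i x -> residual_minimizer (A^T *m A) y i psi ->
  (size phi <= i)%N -> psi = 1 + 'X * phi -> x = mxhorner psi (A^T *m A) *m y.
Proof.
move=> [z [/in_col_spanP[c ->] zmin xE]] [_ psimin] si psiE.
pose d : 'cV[R]_i := - \col_j phi`_j.
have psid : mxhorner psi (A^T *m A) *m y = y - A^T *m (krylov A y i *m d).
  rewrite psiE (mxhorner_1addXmul _ si) mulmxDl mul1mx krylov_mul -mulNmx -sumrN.
  congr (_ + _ *m _); apply: eq_bigr => j _.
  by rewrite !mxE -scaleNr opprK.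
apply: min_enorm_unique.
  pose p : {poly R} := - rVpoly c^T.
  have sp : (size p <= i)%N by rewrite size_polyN size_poly.
  have cp : y - A^T *m (krylov A y i *m c)
      = mxhorner (1 + 'X * p) (A^T *m A) *m y.
    rewrite (mxhorner_1addXmul _ sp) mulmxDl mul1mx krylov_mul -mulNmx -sumrN.
    congr (_ + _ *m _); apply: eq_bigr => j _.
    by rewrite coefN coef_rVpoly_ord mxE scaleNr.
  rewrite xE cp; apply: psimin; split; first exact: size_1addXmul.
  by rewrite hornerD hornerM hornerX hornerC mul0r addr0.
rewrite psid xE.
have -> : 2^-1 *: (y - A^T *m (krylov A y i *m c)
                   + (y - A^T *m (krylov A y i *m d)))
    = y - A^T *m (krylov A y i *m (2^-1 *: (c + d))).
  by rewrite -!scalemxAr !mulmxDr; apply/colP => k; rewrite !mxE; field.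
by apply: zmin; apply/in_col_spanP; eexists.
Qed.

(** * Splitting along the singular vectors *)

Lemma orthogonal_blocks (R : realType) (N l r : nat) (Wl : 'M[R]_(N, l))
    (We : 'M[R]_(N, r)) : orthogonal_mx (row_mx Wl We) ->
  [/\ We^T *m Wl = 0, We^T *m We = 1%:M
    & Wl *m Wl^T + We *m We^T = 1%:M].
Proof.
rewrite /orthogonal_mx tr_row_mx mul_col_row mul_row_col scalar_mx_block.
by move=> [/eq_block_mx[_ _ cross gram] res].
Qed.

Lemma sqnorm_blocks (R : realType) (N l r : nat) (Wl : 'M[R]_(N, l))
    (We : 'M[R]_(N, r)) (u : 'cV[R]_N) : orthogonal_mx (row_mx Wl We) ->
  sqnorm u = sqnorm (Wl^T *m u) + sqnorm (We^T *m u).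
Proof.
move=> /orthogonal_blocks[_ _ res].
rewrite !sqnormE -[X in u^T *m X]mul1mx -res mulmxDl mulmxDr mxE.
by rewrite !trmx_mul !trmxK !mulmxA.
Qed.

Lemma notin_col_span_block (R : realType) (N l r : nat) (Wl : 'M[R]_(N, l))
    (We : 'M[R]_(N, r)) (u : 'cV[R]_N) : orthogonal_mx (row_mx Wl We) ->
  ~~ in_col_span Wl u -> We^T *m u != 0.
Proof.
move=> /orthogonal_blocks[_ _ res].
apply: contra => /eqP u0; apply/in_col_spanP; exists (Wl^T *m u).
by rewrite -[LHS]mul1mx -res mulmxDl -!mulmxA u0 mulmx0 addr0.
Qed.

Lemma diag_mx_sqr (R : realType) (n : nat) (d : 'rV[R]_n) :
  diag_mx d ^+ 2 = diag_mx (\row_j (d 0 j ^+ 2)).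
Proof.
by rewrite expr2 -mulmxE mulmx_diag; congr diag_mx.
Qed.

Lemma quad_diag (R : realType) (n p : nat) (W : 'M[R]_(n, p)) (d : 'rV[R]_p)
    (u : 'cV[R]_n) :
  (u^T *m (W *m diag_mx d ^+ 2 *m W^T) *m u) 0 0
    = \sum_j d 0 j ^+ 2 * (W^T *m u) j 0 ^+ 2.
Proof.
have -> : u^T *m (W *m diag_mx d ^+ 2 *m W^T) *m u
    = (W^T *m u)^T *m (diag_mx d ^+ 2 *m (W^T *m u)).
  by rewrite trmx_mul trmxK !mulmxA.
rewrite diag_mx_sqr mul_diag_mx mxE; apply: eq_bigr => j _.
by rewrite !mxE; ring.
Qed.

Lemma mxhorner_left_eigen (R : realType) (n : nat) (B : 'M[R]_n)
    (w : 'rV[R]_n) (a : R) (p : {poly R}) :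
  w *m B = a *: w -> w *m mxhorner p B = p.[a] *: w.
Proof.
move=> wB; have wBj j : w *m B ^+ j = a ^+ j *: w.
  elim: j => [|j IHj]; first by rewrite !expr0 mulmx1 scale1r.
  by rewrite exprSr -mulmxE mulmxA IHj -scalemxAl wB scalerA exprSr.
rewrite horner_coef scaler_suml mulmx_sumr; apply: eq_bigr => j _.
by rewrite -scalemxAr wBj scalerA.
Qed.

(** The supremum is an upper bound because the set of values is bounded; the
    bound is the sum of the |p_j| b^j. *)
Lemma ler_max_abs_poly (R : realType) (p : {poly R}) (b t : R) :
  0 <= t <= b -> `|p.[t]| <= max_abs_poly p b.
Proof.
move=> /andP[t0 tb]; apply: ub_le_sup; last by exists t; rewrite //= in_itv /= t0.
exists (\sum_(j < size p) `|p`_j| * b ^+ j) => _ [s /= + <-].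
rewrite in_itv /= => /andP[s0 sb].
rewrite horner_coef (le_trans (ler_norm_sum _ _ _))// ler_sum// => j _.
by rewrite normrM ler_wpM2l// normrX ger0_norm// lerXn2r// nnegrE (le_trans s0).
Qed.

(** * The singular value decomposition and the angle *)

Lemma sqnorm_mul_svd (R : realType) (M N l : nat) (A : 'M[R]_(M, N))
    (sigma : nat -> R) (Wl : 'M[R]_(N, l)) (We : 'M[R]_(N, N - l))
    (u : 'cV[R]_N) :
  right_singular_basis A sigma Wl We ->
  sqnorm (A *m u)
    = \sum_(j < l) sigma j.+1 ^+ 2 * (Wl^T *m u) j 0 ^+ 2
      + \sum_(k < N - l) sigma (l + k.+1)%N ^+ 2 * (We^T *m u) k 0 ^+ 2.
Proof.
move=> [_ AA]; rewrite sqnormE trmx_mul mulmxA -(mulmxA u^T) AA.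
rewrite mulmxDr mulmxDl mxE !quad_diag.
by congr (_ + _); apply: eq_bigr => j _; rewrite !mxE.
Qed.

Lemma specnorm_le_sigma1 (R : realType) (M N l : nat) (A : 'M[R]_(M, N))
    (sigma : nat -> R) (Wl : 'M[R]_(N, l)) (We : 'M[R]_(N, N - l))
    (y : 'cV[R]_N) :
  singular_values A sigma -> (l < N)%N ->
  right_singular_basis A sigma Wl We -> enorm y = 1 ->
  specnorm A <= sigma 1%N.
Proof.
move=> [s0 sle _] lN hW y1.
have N0 : (0 < N)%N := leq_ltn_trans (leq0n l) lN.
have sqle1 j : (1 <= j <= N)%N -> sigma j ^+ 2 <= sigma 1%N ^+ 2.
  by move=> /andP[j1 jN]; rewrite ler_sqr ?nnegrE ?s0 ?sle ?j1.
(* The supremum of an empty set is 0 by convention; y makes it nonempty. *)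
apply: ge_sup; first by exists (enorm (A *m y)); exists y.
move=> _ [u /= u1 <-]; rewrite -ler_sqr ?nnegrE ?sqrtr_ge0 ?s0//.
rewrite -[leRHS]mulr1 -[X in _ * X](expr1n _ 2) -u1 !enorm_sqr.
rewrite (sqnorm_mul_svd _ hW) (sqnorm_blocks _ hW.1) mulrDr !mulr_sumr.
apply: lerD; apply: ler_sum => j _; apply: ler_wpM2r; rewrite ?sqr_ge0//.
  by rewrite sqle1//= (leq_trans (ltn_ord j) (ltnW lN)).
by rewrite sqle1// addnS /= -ltn_subRL.
Qed.

(** The rows of We^T are left eigenvectors of A^T A for the squares of the
    trailing singular values, so We^T p(A^T A) y arises from We^T y by
    scaling each entry by some p(sigma_k^2), which is nonzero. *)
Lemma null_component_nonzero (R : realType) (M N l : nat) (A : 'M[R]_(M, N))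
    (sigma : nat -> R) (Wl : 'M[R]_(N, l)) (We : 'M[R]_(N, N - l))
    (y : 'cV[R]_N) (p : {poly R}) :
  right_singular_basis A sigma Wl We -> ~~ in_col_span Wl y ->
  (forall k, (l < k <= N)%N -> p.[sigma k ^+ 2] != 0) ->
  mxhorner p (A^T *m A) *m y != 0.
Proof.
move=> [hW AA] /(notin_col_span_block hW) y0 p0.
have [cross gram _] := orthogonal_blocks hW.
apply: contra y0 => /eqP py0; apply/eqP/row_matrixP => k; rewrite row0 row_mul.
have eig : row k We^T *m (A^T *m A)
    = sigma (l + k.+1)%N ^+ 2 *: row k We^T.
  rewrite -row_mul AA /Sigma_eps /Sigma_l !diag_mx_sqr mulmxDr !mulmxA.
  rewrite cross gram !mul0mx add0r mul1mx.
  by apply/rowP => j; rewrite mul_diag_mx !mxE.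
have := congr1 (mulmx (row k We^T)) py0.
rewrite mulmx0 mulmxA (mxhorner_left_eigen _ eig) -scalemxAl.
move/eqP; rewrite scaler_eq0 (negPf (p0 _ _)) ?orFb => [/eqP//|].
by rewrite addnS ltnS leq_addr /= -ltn_subRL.
Qed.

Lemma sin_angle_complement (R : realType) (N l r : nat) (Wl : 'M[R]_(N, l))
    (We : 'M[R]_(N, r)) (u : 'cV[R]_N) :
  orthogonal_mx (row_mx Wl We) -> u != 0 ->
  sin (angle We u) = enorm (Wl^T *m u) / enorm u.
Proof.
move=> hW u0; have su : 0 < sqnorm u by rewrite lt_def sqnorm_eq0 u0 sqnorm_ge0.
have eu : 0 < enorm u by rewrite enormE sqrtr_gt0.
have uE := sqnorm_blocks u hW.
have we_le : enorm (We^T *m u) <= enorm u.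
  by rewrite ler_enorm uE lerDr sqnorm_ge0.
have c0 : 0 <= enorm (We^T *m u) / enorm u.
  by rewrite divr_ge0// sqrtr_ge0.
rewrite /angle sin_acos; last first.
  by rewrite (le_trans _ c0) ?lerN10 //= ler_pdivrMr// mul1r.
rewrite expr_div_n !enorm_sqr.
have -> : 1 - sqnorm (We^T *m u) / sqnorm u = sqnorm (Wl^T *m u) / sqnorm u.
  by rewrite uE in su *; field; rewrite gt_eqF.
by rewrite sqrtrM ?sqnorm_ge0// sqrtrV// ltW.
Qed.

Unset Implicit Arguments.
Set Strict Implicit.
Set Printing Implicit Defensive.

Theorem theorem3p3 (R : realType) (M N : nat) (A : 'M[R]_(M, N))
  (sigma : nat -> R) (l : nat)
  (Wl : 'M[R]_(N, l)) (We : 'M[R]_(N, N - l))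
  (kappa eps : R) (y : 'cV[R]_N) (tol : R) (i : nat) (x : 'cV[R]_N)
  (psi psihat phi phihat : {poly R})
  (hsigma : singular_values A sigma)
  (hsigma1 : sigma 1%N = 1)
  (hl : (1 <= l < N)%N)
  (hgap : sigma l.+1 < sigma l)
  (hkappa : kappa = sigma 1%N / sigma l)
  (heps : eps = sigma l.+1 / sigma 1%N)
  (hW : right_singular_basis A sigma Wl We)
  (hy1 : enorm y = 1)
  (hy : ~~ in_col_span Wl y)
  (htol : 0 < tol)
  (hi : (1 <= i)%N)
  (hterm : lsqrnv_terminates A y tol i x)
  (hpsi : residual_minimizer (A^T *m A) y i psi)
  (hpsihat : residual_minimizer (Sigma_l sigma l ^+ 2) (Wl^T *m y) i psihat)
  (hphi : (size phi <= i)%N /\ psi = 1 + 'X * phi)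
  (hphihat : (size phihat <= i)%N /\ psihat = 1 + 'X * phihat)
  (hDelta : Delta phi phihat eps * eps ^+ 2 < 1) :
  x != 0 /\ sin (angle We x) <= kappa * tol.
Proof.
have [/andP[l1 lN] [s0 sle _]] := (hl, hsigma).
have epsE : eps = sigma l.+1 by rewrite heps hsigma1 divr1.
have sl1_ge0 : 0 <= sigma l.+1 by rewrite s0.
have sl_gt0 : 0 < sigma l := le_lt_trans sl1_ge0 hgap.
have [_ hx stop _] := hterm; have [sphi psiE] := hphi.
have x0 : x != 0.
  rewrite (lsqrnv_iterateE hx hpsi sphi psiE).
  apply: (null_component_nonzero hW hy) => k /andP[lk kN].
  have [skl sk0] : sigma k ^+ 2 <= eps ^+ 2 /\ 0 <= sigma k ^+ 2.
    split; last exact: sqr_ge0.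
    have k1 : (0 < k)%N := leq_ltn_trans (leq0n _) lk.
    by rewrite epsE ler_sqr ?nnegrE ?s0 ?sle ?k1.
  set t := sigma k ^+ 2 in skl sk0 *.
  have phit : `|phi.[t]| <= Delta phi phihat eps.
    by rewrite le_max ler_max_abs_poly ?sk0.
  apply/eqP => pt.
  (* A zero of psi = 1 + 'X * phi at t would force phi(t) t = -1. *)
  suff : `|phi.[t] * t| < 1.
    have -> : phi.[t] * t = -1.
      move/eqP: pt; rewrite psiE hornerD hornerM hornerX hornerC mulrC.
      by rewrite addrC addr_eq0 => /eqP.
    by rewrite normrN1 ltxx.
  apply: le_lt_trans hDelta; rewrite normrM (ger0_norm sk0).
  by apply: ler_pM.
split => //; rewrite (sin_angle_complement hW.1)//.
have ex : 0 < enorm x.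
  by rewrite enormE sqrtr_gt0 lt_def sqnorm_eq0 x0 sqnorm_ge0.
rewrite ler_pdivrMr// hkappa hsigma1 mul1r -mulrA ler_pdivlMl//.
have A1 := specnorm_le_sigma1 hsigma lN hW hy1; rewrite hsigma1 in A1.
apply: le_trans (_ : enorm (A *m x) <= _); last first.
  apply: le_trans stop _; rewrite [tol * _]mulrC; apply: ler_wpM2r; first exact: ltW.
  by rewrite ler_piMl// ltW.
have -> : sigma l * enorm (Wl^T *m x)
    = Num.sqrt (sigma l ^+ 2 * sqnorm (Wl^T *m x)).
  by rewrite sqrtrM ?sqr_ge0// sqrtr_sqr gtr0_norm.
rewrite enormE ler_wsqrtr// (sqnorm_mul_svd _ hW).
(* The trailing terms of |A x|^2 are dropped. *)
rewrite -[leLHS]addr0 mulr_sumr; apply: lerD; last first.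
  by apply: sumr_ge0 => k _; rewrite mulr_ge0 ?sqr_ge0.
apply: ler_sum => j _; apply: ler_wpM2r; first exact: sqr_ge0.
have jN : (j.+1 <= N)%N := leq_trans (ltn_ord j) (ltnW lN).
by rewrite ler_sqr ?nnegrE ?s0 ?sle ?jN ?l1 ?(ltnW lN) ?ltn_ord.
Qed.
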